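(* Let $(X,d)$ be a Hadamard space, let $A \subset X$ be a nonempty finite set, and let $\bar x \in X$. Define $f_{A,\bar x} \colon X \to \mathbb{R}$ by $f_{A,\bar x}(x) = \frac{1}{2}\max_{a \in A}\{ d(a,x)^2 - d(a,\bar x)^2 \}$. Then $\bar x \in \mathrm{mean}(A)$ if and only if the slope satisfies $|\nabla f_{A,\bar x}|(\bar x) = 0$.
   Context: A Hadamard space is a complete CAT(0) geodesic space. Let $\Delta^A = \{ w \in \mathbb{R}^A : w_a \ge 0 \ \forall a\in A,\ \sum_{a \in A} w_a = 1\}$. The mean set $\mathrm{mean}(A)$ is the set of points $\bar x \in X$ for which there exists $w \in \Delta^A$ such that $\bar x$ minimizes $x \mapsto \sum_{a\in A} w_a d(a,x)^2$ over $X$. For a function $f \colon X \to \mathbb{R}$ on a metric space and a point $\bar x \in X$, the slope $|\nabla f|(\bar x)$ is zero if $\bar x$ is a local minimizer of $f$, and otherwise is $\limsup_{x \to \bar x,\, x\neq \bar x} \frac{f(\bar x) - f(x)}{d(\bar x,x)}$. *)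

(* Defs.v *)
From HB Require Import structures.
From mathcomp Require Import all_boot all_order all_algebra finmap.
From mathcomp Require Import all_classical all_reals all_analysis.
Set Implicit Arguments.
Unset Strict Implicit.
Unset Printing Implicit Defensive.
Import Order.TTheory GRing.Theory Num.Theory.
Import numFieldNormedType.Exports.

Local Open Scope classical_set_scope.
Local Open Scope ring_scope.

Definition eucl_dist (R : realType) (u v : 'rV[R]_2) : R :=
  Num.sqrt (\sum_i (u 0 i - v 0 i) ^+ 2).

Definition complete_metric (R : realType) (X : metricType R) : Prop :=
  forall F : set_system X, ProperFilter F -> cauchy F -> exists x : X, F --> x.

(* Geodesics are parametrized with constant speed on [0, 1]; the values of [g]
   outside [0, 1] are irrelevant. *)
Definition is_geodesic (R : realType) (X : metricType R)
    (x y : X) (g : R -> X) : Prop :=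
  [/\ g 0 = x, g 1 = y &
      forall s t : R, 0 <= s <= 1 -> 0 <= t <= 1 ->
        mdist (g s) (g t) = `|s - t| * mdist x y].

Definition geodesic_space (R : realType) (X : metricType R) : Prop :=
  forall x y : X, exists g : R -> X, is_geodesic x y g.

(* [v] lists the vertices of a geodesic triangle, whose side number [i] is the
   geodesic [g i] from [v i] to [v (ordS i)] ([ordS] is the cyclic successor),
   and [v'] lists the vertices of a comparison triangle in the Euclidean plane.
   The comparison point of [g i s] divides the corresponding side of the
   comparison triangle in the same ratio. *)
Definition CAT0 (R : realType) (X : metricType R) : Prop :=
  forall (v : 'I_3 -> X) (g : 'I_3 -> R -> X) (v' : 'I_3 -> 'rV[R]_2),
    (forall i, is_geodesic (v i) (v (ordS i)) (g i)) ->
    (forall i j, eucl_dist (v' i) (v' j) = mdist (v i) (v j)) ->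
    forall (i j : 'I_3) (s t : R), 0 <= s <= 1 -> 0 <= t <= 1 ->
      mdist (g i s) (g j t) <=
        eucl_dist ((1 - s) *: v' i + s *: v' (ordS i))
                  ((1 - t) *: v' j + t *: v' (ordS j)).

Definition hadamard_space (R : realType) (X : metricType R) : Prop :=
  [/\ complete_metric X, geodesic_space X & CAT0 X].

Definition simplex (R : realType) (I : finType) : set {ffun I -> R} :=
  [set w | (forall i, 0 <= w i) /\ \sum_i w i = 1].

Definition mean_set (R : realType) (X : metricType R) (A : {fset X}) : set X :=
  [set xbar | exists2 w : {ffun A -> R}, simplex w &
    forall x : X, \sum_(a : A) w a * mdist (val a) xbar ^+ 2
               <= \sum_(a : A) w a * mdist (val a) x ^+ 2].

(* The maximum of [F] over [I], with value 0 by convention if [I] is empty;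
   it does not depend on the element [i0] chosen by [pick]. *)
Definition finmax (R : realType) (I : finType) (F : I -> R) : R :=
  if [pick i : I] is Some i0 then \big[Num.max/F i0]_(i : I) F i else 0.

Definition max_diff (R : realType) (X : metricType R) (A : {fset X}) (xbar : X)
    (x : X) : R :=
  2^-1 * finmax (fun a : A => mdist (val a) x ^+ 2 - mdist (val a) xbar ^+ 2).

Definition local_minimizer (R : realType) (X : metricType R) (f : X -> R)
    (xbar : X) : Prop :=
  \forall x \near xbar, f xbar <= f x.

(* Extended-real valued: the upper limit may be infinite. *)
Definition slope (R : realType) (X : metricType R) (f : X -> R) (xbar : X) :
    \bar R :=
  if `[< local_minimizer f xbar >] then 0%E
  else limf_esup (fun x => ((f xbar - f x) / mdist xbar x)%:E) xbar^'.

(* Main.v *)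
(* Both conditions are equivalent to f >= 0 on X, where f = f_{A,xbar} vanishes
   at xbar. The CAT(0) inequality makes each d(a, .)^2, hence f, convex along
   geodesics, so if f x < 0 for some x, then along the geodesic from xbar to x
   the function f decreases at rate at least - f x / d(xbar, x) and the slope is
   positive. Conversely, f >= 0 says that the convex functions
   d(a, .)^2 - d(a, xbar)^2 are never simultaneously negative; by a theorem of
   the alternative some convex combination of them is nonnegative, and its
   weights exhibit xbar as a mean of A. *)
Require Import Defs.
From HB Require Import structures.
From mathcomp Require Import all_boot all_order all_algebra finmap.
From mathcomp Require Import all_classical all_reals all_analysis.
From mathcomp Require Import ring lra.
Import Order.TTheory GRing.Theory Num.Theory.
Import numFieldNormedType.Exports.
Local Open Scope classical_set_scope.
Local Open Scope ring_scope.

(** * A theorem of the alternative for convexlike families *)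

Section ConvexAlternative.
Context {R : realType} {T : Type}.
Implicit Types (C : set T) (t m : R).

(** Fan's notion: one [z] serves all indices at once, so [T] needs no linear or geodesic
    structure. *)
Definition convexlike {I : Type} C (f : I -> T -> R) : Prop :=
  forall x y t, C x -> C y -> 0 <= t <= 1 ->
    exists2 z, C z & forall i, f i z <= (1 - t) * f i x + t * f i y.

(* Both functions are negative at the point dividing the segment between [x]
   and [y] in a suitable ratio as soon as this cross inequality fails. *)
Lemma convexlike_cross C (f : bool -> T -> R) x y :
  convexlike C f -> (forall z, C z -> f false z < 0 -> 0 <= f true z) ->
  C x -> C y -> f false x < 0 -> f true y < 0 ->
  f true y * f false x <= f true x * f false y.
Proof.
move=> cf H Cx Cy qx py; rewrite leNgt; apply/negP => lt.
have px := H _ Cx qx.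
have qy : 0 <= f false y.
  by rewrite leNgt; apply/negP => /(H _ Cy); rewrite leNgt py.
set d := f true x - f true y.
set e := f false y - f false x.
have d0 : 0 < d by rewrite /d; lra.
have e0 : 0 < e by rewrite /e; lra.
(* The convexity bound for [f true] is negative beyond [f true x / d], that for [f false] before
   [- f false x / e]. The failed cross inequality says that the first threshold is the smaller; [t]
   is their midpoint. *)
pose t := (f true x / d + - f false x / e) / 2.
have pd : 0 <= f true x / d by rewrite divr_ge0 // ltW.
have qe : 0 < - f false x / e by rewrite divr_gt0 // oppr_gt0.
have pde : f true x / d < - f false x / e.
  by rewrite ltr_pdivrMr // mulrAC ltr_pdivlMr // /d /e; nra.
have qe1 : - f false x / e <= 1 by rewrite ler_pdivrMr // /e; lra.
have t01 : 0 <= t <= 1 by rewrite /t; apply/andP; split; lra.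
have [z Cz fz] := cf x y t Cx Cy t01.
have qz : f false z < 0.
  apply: le_lt_trans (fz false) _.
  have : t * e < - f false x by rewrite -ltr_pdivlMr // /t; lra.
  rewrite /e; lra.
have pz : f true z < 0.
  apply: le_lt_trans (fz true) _.
  have : f true x < t * d by rewrite -ltr_pdivrMr // /t; lra.
  rewrite /d; lra.
by have := H _ Cz qz; rewrite leNgt pz.
Qed.

(** Points with [f false x < 0] bound [m] above by [f true x / - f false x]; points with
    [f true y < 0] bound it below by [- f true y / f false y]. The cross inequality makes these
    bounds compatible, so the infimum of the upper ones works. *)
Lemma convexlike_alternative2 C (f : bool -> T -> R) :
  convexlike C f -> (forall z, C z -> f false z < 0 -> 0 <= f true z) ->
  (exists2 x, C x & f false x < 0) ->
  exists2 m, 0 <= m & forall x, C x -> 0 <= f true x + m * f false x.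
Proof.
move=> cf H [x0 Cx0 qx0].
pose S := [set f true x / - f false x | x in [set x | C x /\ f false x < 0]].
have S0 : S !=set0 by exists (f true x0 / - f false x0), x0.
have Slb : lbound S 0.
  move=> _ [x [Cx qx] <-]; rewrite divr_ge0 //; first exact: H.
  by rewrite oppr_ge0 ltW.
exists (inf S); first exact: lb_le_inf.
move=> y Cy; have [qy|qy] := ltP (f false y) 0.
  suff : inf S * - f false y <= f true y by lra.
  rewrite -ler_pdivlMr ?oppr_gt0 //; apply: ge_inf; first by exists 0.
  by exists y.
have [py|py] := leP 0 (f true y).
  by rewrite addr_ge0 // mulr_ge0 // lb_le_inf.
have cross x : C x -> f false x < 0 ->
    f true y * f false x <= f true x * f false y.
  by move=> Cx qx; exact: (convexlike_cross C f x y).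
(* If [f false y] were 0, the cross inequality at [x0] would make a product of two negative numbers
   nonpositive. *)
have qy0 : 0 < f false y.
  rewrite lt_neqAle qy andbT; apply/negP => /eqP qy0.
  by have := cross _ Cx0 qx0; rewrite -qy0 mulr0 leNgt nmulr_rgt0 // qx0.
suff : - f true y <= inf S * f false y by lra.
rewrite -ler_pdivrMr //; apply: lb_le_inf => // _ [x [Cx qx] <-].
rewrite ler_pdivlMr ?oppr_gt0 // mulrAC ler_pdivrMr //.
by have := cross _ Cx qx; lra.
Qed.

(* Fan's alternative, by induction on the number of functions: dropping [f i]
   and restricting to [f i < 0] yields a combination that is nonnegative
   wherever [f i] is negative, and two functions remain. *)
Lemma convexlike_alternative {I : finType} (s : seq I) C (f : I -> T -> R) :
  convexlike C f -> C !=set0 ->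
  (forall x, C x -> exists2 i, i \in s & 0 <= f i x) ->
  exists w : I -> R, [/\ forall i, 0 <= w i, \sum_i w i = 1 &
    forall x, C x -> 0 <= \sum_i w i * f i x].
Proof.
elim: s C => [|j s IHs] C cf [c Cc] H; first by have [] := H c Cc.
pose del i : R := (i == j)%:R.
have sumdel (g : I -> R) : \sum_i del i * g i = g j.
  rewrite (bigD1 j) //= /del eqxx mul1r big1 ?addr0 // => i /negbTE ->.
  by rewrite mul0r.
have sumdel1 : \sum_i del i = 1.
  by rewrite -(sumdel (fun=> 1)); apply: eq_bigr => i _; rewrite mulr1.
(* If [f j] is never negative on [C], all the weight goes to [j]. *)
have [[x1 Cx1 jx1]|nex] := pselect (exists2 x, C x & f j x < 0); last first.
  exists del; split => [i||x Cx] //.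
  by rewrite sumdel leNgt; apply/negP => jx; apply: nex; exists x.
pose C' := [set x | C x /\ f j x < 0].
have [||x [Cx jx]|w [w0 w1 wf]] := IHs C'.
- move=> x y t [Cx jx] [Cy jy] t01; have [z Cz fz] := cf x y t Cx Cy t01.
  exists z => //; split => //; apply: le_lt_trans (fz j) _.
  by move: t01 => /andP[t0 t1]; nra.
- by exists x1.
- have [i] := H x Cx; rewrite inE => /predU1P[->|si fi]; last by exists i.
  by rewrite leNgt jx.
pose p x := \sum_i w i * f i x.
have [|||m m0 mf] :=
  convexlike_alternative2 C (fun b => if b then p else f j).
- move=> x y t Cx Cy t01; have [z Cz fz] := cf x y t Cx Cy t01.
  exists z => // -[|//]; rewrite /p !mulr_sumr -big_split /=.
  apply: ler_sum => i _.
  have -> : (1 - t) * (w i * f i x) + t * (w i * f i y) =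
      w i * ((1 - t) * f i x + t * f i y) by ring.
  exact: ler_wpM2l.
- by move=> x Cx jx; exact: wf.
- by exists x1.
have m1 : 0 < 1 + m by lra.
(* The weights of [p + m * f j] have total mass [1 + m]. *)
exists (fun i => (w i + m * del i) / (1 + m)); split.
- by move=> i; rewrite divr_ge0 ?(ltW m1) // addr_ge0 // mulr_ge0.
- rewrite -mulr_suml big_split /= w1 -mulr_sumr sumdel1 mulr1 divff //.
  by rewrite gt_eqF.
- move=> x Cx.
  have -> : \sum_i (w i + m * del i) / (1 + m) * f i x =
      (p x + m * f j x) / (1 + m).
    rewrite -(sumdel (f^~ x)) /p mulr_sumr -big_split /= mulr_suml.
    by apply: eq_bigr => i _; ring.
  by rewrite divr_ge0 ?(ltW m1) //; exact: mf.
Qed.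

End ConvexAlternative.

(** * Bounds on finite maxima *)

Section FinMax.
Context {R : realType} {I : finType}.
Implicit Types (F : I -> R) (c : R).

Lemma finmax_ub F i : F i <= finmax F.
Proof.
by rewrite /finmax; case: pickP => [i0 _|/(_ i)//]; exact: le_bigmax.
Qed.

Lemma finmax_le F c : (0 < #|I|)%N -> (forall i, F i <= c) -> finmax F <= c.
Proof.
rewrite /finmax => /card_gt0P[i _] H; case: pickP => [i0 _|/(_ i)//].
by apply/bigmax_leP; split.
Qed.

Lemma finmax_lt F c : (0 < #|I|)%N -> (forall i, F i < c) -> finmax F < c.
Proof.
rewrite /finmax => /card_gt0P[i _] H; case: pickP => [i0 _|/(_ i)//].
by apply/bigmax_ltP; split.
Qed.

End FinMax.

(** * Comparison triangles and convexity of the squared distance *)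

Section Comparison.
Context {R : realType}.

Lemma eucl_dist_sqr (u v : 'rV[R]_2) :
  eucl_dist u v ^+ 2 = \sum_i (u 0 i - v 0 i) ^+ 2.
Proof. by rewrite sqr_sqrtr // sumr_ge0 // => i _; rewrite sqr_ge0. Qed.

Lemma eucl_dist_sqr_convex (u v p : 'rV[R]_2) (t : R) : 0 <= t <= 1 ->
  eucl_dist ((1 - t) *: u + t *: v) p ^+ 2 <=
  (1 - t) * eucl_dist u p ^+ 2 + t * eucl_dist v p ^+ 2.
Proof.
move=> /andP[t0 t1]; rewrite !eucl_dist_sqr !mulr_sumr -big_split /=.
apply: ler_sum => i _; rewrite !mxE -subr_ge0.
have -> : (1 - t) * (u 0 i - p 0 i) ^+ 2 + t * (v 0 i - p 0 i) ^+ 2 -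
    ((1 - t) * u 0 i + t * v 0 i - p 0 i) ^+ 2 =
    t * (1 - t) * (u 0 i - v 0 i) ^+ 2 by ring.
by rewrite mulr_ge0 ?sqr_ge0 // mulr_ge0 // subr_ge0.
Qed.

Lemma eucl_dist_xx (u : 'rV[R]_2) : eucl_dist u u = 0.
Proof. by rewrite /eucl_dist big1 ?sqrtr0 // => i _; rewrite subrr expr0n. Qed.

Lemma eucl_dist_sym (u v : 'rV[R]_2) : eucl_dist u v = eucl_dist v u.
Proof.
by rewrite /eucl_dist; congr Num.sqrt; apply: eq_bigr => i _; rewrite -sqrrN opprB.
Qed.

(** The side of length [a] is laid on the first axis from the origin; the law of cosines gives the
    abscissa [x] of the apex. *)
Lemma euclidean_triangle (a b c : R) : 0 <= a -> 0 <= b -> 0 <= c ->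
  a <= b + c -> b <= c + a -> c <= a + b ->
  exists u v p : 'rV[R]_2,
    [/\ eucl_dist u v = a, eucl_dist v p = b & eucl_dist p u = c].
Proof.
move=> a0 b0 c0 abc bca cab.
have dE (u v : 'rV[R]_2) (r : R) : 0 <= r ->
    (u 0 ord0 - v 0 ord0) ^+ 2 + (u 0 (lift ord0 ord0) - v 0 (lift ord0 ord0)) ^+ 2
      = r ^+ 2 -> eucl_dist u v = r.
  move=> r0 E; rewrite /eucl_dist !big_ord_recl big_ord0 addr0 E.
  by rewrite sqrtr_sqr ger0_norm.
pose pt (x y : R) : 'rV[R]_2 := \row_j (if j == ord0 then x else y).
have [x [y [xy1 xy2]]] : exists x y : R,
    x ^+ 2 + y ^+ 2 = c ^+ 2 /\ (a - x) ^+ 2 + y ^+ 2 = b ^+ 2.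
  (* For [a = 0] the formula for [x] would divide by zero, but then [b = c]. *)
  have [a_eq0|a_neq0] := eqVneq a 0.
    exists c, 0; rewrite a_eq0.
    have -> : b = c by lra.
    by split; ring.
  pose x := (a ^+ 2 + c ^+ 2 - b ^+ 2) / (2 * a).
  have ax : 2 * a * x = a ^+ 2 + c ^+ 2 - b ^+ 2 by rewrite /x; field.
  have ap : 0 < a by rewrite lt_neqAle eq_sym a_neq0.
  (* The triangle inequalities give [- c <= x <= c], so the ordinate is a real square root. *)
  have xc : x <= c by rewrite /x ler_pdivrMr; [nra | lra].
  have cx : - c <= x by rewrite /x ler_pdivlMr; [nra | lra].
  exists x, (Num.sqrt (c ^+ 2 - x ^+ 2)); rewrite sqr_sqrtr; last by nra.
  by split; [ring | lra].
exists (pt 0 0), (pt a 0), (pt x y).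
by split; apply: dE => //; rewrite !mxE /= -?xy1 -?xy2; ring.
Qed.

Lemma CAT0_sqr_dist_convex (X : metricType R) (x y a : X) (g : R -> X) (t : R) :
  geodesic_space X -> CAT0 X -> is_geodesic x y g -> 0 <= t <= 1 ->
  mdist a (g t) ^+ 2 <= (1 - t) * mdist a x ^+ 2 + t * mdist a y ^+ 2.
Proof.
move=> gX cX gxy t01.
have [h gya] := gX y a; have [k gax] := gX a x.
have tri (p q r : X) : mdist p r <= mdist p q + mdist q r.
  exact: metric_triangle.
have sym (p q : X) : mdist p q = mdist q p by exact: metric_sym.
have [|||||| u [v [p [uv vp pu]]]] :=
    @euclidean_triangle (mdist x y) (mdist y a) (mdist a x).
- exact: mdist_ge0.
- exact: mdist_ge0.
- exact: mdist_ge0.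
- by have := tri x a y; rewrite (sym x a) (sym a y); lra.
- by have := tri y x a; rewrite (sym x a) (sym y x); lra.
- by have := tri a y x; rewrite (sym y x) (sym a y); lra.
pose tr S (s : S * S * S) (i : 'I_3) : S :=
  match val i with 0%N => s.1.1 | 1%N => s.1.2 | _ => s.2 end.
(* The third side starts at [a], so parameter 0 on it compares [g t] with the vertex [a] itself,
   whose comparison point is [p]. *)
have /(_ _ _ (inord 0) (inord 2) t 0 t01) :=
  cX (tr X (x, y, a)) (tr _ (g, h, k)) (tr _ (u, v, p)).
rewrite /tr /= !inordK //= scale0r addr0 subr0 scale1r.
have [-> _ _] := gax; rewrite lexx ler01 => le.
have {}le : mdist (g t) a <= eucl_dist ((1 - t) *: u + t *: v) p.
  apply: le => //.
  - by case=> [[|[|[|]]]].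
  - case=> [[|[|[|//]]] ?]; case=> [[|[|[|//]]] ?] /=;
      rewrite ?eucl_dist_xx ?mdistxx //.
    + by rewrite eucl_dist_sym pu metric_sym.
    + by rewrite eucl_dist_sym uv metric_sym.
    + by rewrite eucl_dist_sym vp metric_sym.
rewrite metric_sym -pu (metric_sym a) -vp eucl_dist_sym.
apply: le_trans (eucl_dist_sqr_convex u v p t t01).
by rewrite ler_sqr // nnegrE ?mdist_ge0 // sqrtr_ge0.
Qed.

End Comparison.

(** * Positive and zero slopes *)

Section Slope.
Context {R : realType} {X : metricType R}.

Lemma limf_esup_ge (f : X -> \bar R) (F : set_system X) (c : \bar R) :
  (forall V, F V -> exists2 x, V x & (c <= f x)%E) -> (c <= limf_esup f F)%E.
Proof.
move=> H; apply: le_ereal_inf_tmp => _ [V FV <-].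
have [x Vx cfx] := H V FV.
by apply: le_ereal_sup_tmp; exists (f x) => //; exists x.
Qed.

Lemma geodesic_dist_left (x y : X) (g : R -> X) (t : R) :
  is_geodesic x y g -> 0 <= t <= 1 -> mdist x (g t) = t * mdist x y.
Proof.
move=> [g0 _ gd] t01; rewrite -{1}g0 gd ?lexx ?ler01 //.
by rewrite sub0r normrN ger0_norm //; case/andP: t01.
Qed.

Lemma slope_gt0 (f : X -> R) (x y : X) (g : R -> X) :
  is_geodesic x y g -> f x = 0 -> f y < 0 ->
  (forall t, 0 <= t <= 1 -> f (g t) <= t * f y) ->
  (0 < slope f x)%E.
Proof.
move=> gxy fx fy fg.
have dxy : 0 < mdist x y.
  by rewrite mdist_gt0; apply/eqP => xy; move: fy; rewrite -xy fx ltxx.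
have near V : nbhs x V -> exists2 t, 0 < t <= 1 & V (g t).
  move=> /nbhs_ballP[e /= e0 eV].
  (* The cap 1 keeps [t] in the parameter range; the factor 2 puts [g t] within [e / 2] of [x],
     strictly inside the ball. *)
  pose t := Num.min 1 (e / (2 * mdist x y)).
  have d0 : 0 < 2 * mdist x y by rewrite mulr_gt0.
  have t0 : 0 < t by rewrite lt_min ltr01 divr_gt0.
  have t1 : t <= 1 by rewrite ge_min lexx.
  exists t; first by rewrite t0 t1.
  apply: eV; rewrite ballEmdist /= (geodesic_dist_left _ _ _ _ gxy) ?(ltW t0) //.
  have : t <= e / (2 * mdist x y) by rewrite ge_min lexx orbT.
  by rewrite ler_pdivlMr //; lra.
rewrite /slope; case: asboolP => [|_].
  move=> /near[t /andP[t0 t1]]; rewrite fx leNgt => /negP[].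
  by apply: le_lt_trans (fg t _) _; rewrite ?(ltW t0) // pmulr_rlt0.
apply: (@lt_le_trans _ _ ((- f y / mdist x y)%:E)).
  by rewrite lte_fin divr_gt0 // oppr_gt0.
apply: limf_esup_ge => V /near[t /andP[t0 t1] Vt].
have dt : mdist x (g t) = t * mdist x y.
  by apply: geodesic_dist_left; rewrite ?(ltW t0).
(* [V] is only a deleted neighbourhood, so [g t] must differ from [x]; their distance
   [t * mdist x y] is positive. *)
exists (g t).
  apply: Vt; apply/eqP => gt.
  by move: dt; rewrite gt mdistxx => /esym/eqP; rewrite gt_eqF // mulr_gt0.
rewrite lee_fin dt fx sub0r ler_pdivlMr ?mulr_gt0 //.
have -> : - f y / mdist x y * (t * mdist x y) = - (t * f y).
  by field; rewrite gt_eqF.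
by rewrite lerN2 fg // (ltW t0).
Qed.

Lemma slope_global_minimizer (f : X -> R) (x : X) :
  (forall y, f x <= f y) -> slope f x = 0%E.
Proof.
move=> fmin; rewrite /slope; case: asboolP => // -[].
exact: nearW.
Qed.

End Slope.

(** * The equivalence through nonnegativity of [max_diff] *)

Section MaxDiff.
Context {R : realType} {X : metricType R}.
Variables (A : {fset X}) (xbar : X).
Hypothesis A0 : (0 < #|{: A}|)%N.

Lemma max_diff_center : max_diff A xbar xbar = 0.
Proof.
rewrite /max_diff; set F := (X in finmax X).
have [i _] := card_gt0P A0.
have F0 j : F j = 0 by rewrite /F subrr.
suff -> : finmax F = 0 by rewrite mulr0.
apply/eqP; rewrite eq_le finmax_le //= => [|j]; last by rewrite F0.
by rewrite -(F0 i) finmax_ub.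
Qed.

Lemma max_diff_ge0P : geodesic_space X -> CAT0 X ->
  (forall x, 0 <= max_diff A xbar x) <-> slope (max_diff A xbar) xbar = 0%E.
Proof.
move=> gX cX; split=> [f0|slope0 x].
  by apply: slope_global_minimizer => x; rewrite max_diff_center.
rewrite leNgt; apply/negP => fx.
have [g gxy] := gX xbar x.
suff : (0 < slope (max_diff A xbar) xbar)%E by rewrite slope0 ltxx.
apply: (slope_gt0 _ _ _ _ gxy max_diff_center fx) => t t01.
rewrite /max_diff mulrCA ler_pM2l ?invr_gt0 //.
apply: finmax_le => // a.
(* Each difference vanishes at [xbar], so convexity bounds it at [g t] by [t] times its value at
   [x], hence by [t] times the maximum there. *)
have := CAT0_sqr_dist_convex _ _ _ (val a) _ _ gX cX gxy t01.
have /(ler_wpM2l (proj1 (andP t01))) := finmax_ub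
  (fun a : A => mdist (val a) x ^+ 2 - mdist (val a) xbar ^+ 2) a.
by rewrite mulrBr; lra.
Qed.

Lemma mean_setP : geodesic_space X -> CAT0 X ->
  mean_set A xbar <-> forall x, 0 <= max_diff A xbar x.
Proof.
move=> gX cX.
pose F (a : A) x := mdist (val a) x ^+ 2 - mdist (val a) xbar ^+ 2.
have FE (w : A -> R) x : \sum_a w a * F a x =
    \sum_a w a * mdist (val a) x ^+ 2 - \sum_a w a * mdist (val a) xbar ^+ 2.
  by rewrite -sumrB; apply: eq_bigr => a _; rewrite mulrBr.
split=> [[w [w0 w1] wmin] x|f0].
  rewrite mulr_ge0 ?invr_ge0 //.
  have -> : finmax (F^~ x) = \sum_a w a * finmax (F^~ x).
    by rewrite -mulr_suml w1 mul1r.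
  apply: (@le_trans _ _ (\sum_a w a * F a x)).
    by rewrite FE subr_ge0.
  by apply: ler_sum => a _; apply: ler_wpM2l => //; exact: (finmax_ub (F^~ x)).
have [|||w [w0 w1 wF]] := convexlike_alternative (enum {: A}) [set: X] F.
- move=> x y t _ _ t01; have [g gxy] := gX x y.
  exists (g t) => // a.
  by have := CAT0_sqr_dist_convex _ _ _ (val a) _ _ gX cX gxy t01; rewrite /F; lra.
- by exists xbar.
(* Were all the [F a x] negative, their finite maximum would be negative too. *)
- move=> x _; have := f0 x; rewrite pmulr_rge0 ?invr_gt0 // => Fx.
  apply: contrapT => nex; move: Fx; rewrite leNgt => /negP[].
  apply: finmax_lt => // a; rewrite ltNge; apply/negP => Fa; apply: nex.
  by exists a => //; rewrite mem_enum.
exists [ffun a => w a].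
  by split=> [a|]; rewrite ?ffunE //; under eq_bigr do rewrite ffunE.
move=> x; under eq_bigr do rewrite ffunE.
under [leRHS]eq_bigr do rewrite ffunE.
by rewrite -subr_ge0 -FE wF.
Qed.

End MaxDiff.

Theorem corollary7p5 (R : realType) (X : metricType R) (hX : hadamard_space X)
    (A : {fset X}) (hA : A != fset0) (xbar : X) :
  mean_set A xbar <-> slope (max_diff A xbar) xbar = 0%E.
Proof.
have [_ gX cX] := hX.
have A0 : (0 < #|{: A}|)%N by rewrite -cardfE cardfs_gt0.
exact: iff_trans (mean_setP _ _ A0 gX cX) (max_diff_ge0P _ _ A0 gX cX).
Qed.
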